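(* Let $H$ be a nonzero real Hilbert space, identified with its dual, let $I\colon H \to H$ be the identity map, and let $S\colon H \rightrightarrows H$ be a closed and monotone multifunction with nonempty graph. Then $S$ is quasidense if, and only if, $S + I$ is surjective.
   Context: $\langle\cdot,\cdot\rangle$ is the inner product of $H$. A multifunction $S\colon H \rightrightarrows H$ assigns to each $x\in H$ a (possibly empty) subset $S(x)$ of $H$; its graph is $G(S) = \{(x,x^* ) \in H \times H : x^* \in S(x)\}$. $S$ is closed if $G(S)$ is a (norm-)closed subset of $H \times H$, and monotone if $\langle s - t, s^* - t^*\rangle \ge 0$ for all $(s,s^* ),(t,t^* ) \in G(S)$. $S + I$ is the multifunction $x \mapsto \{s^* + x : s^* \in S(x)\}$, and it is surjective if $\{s + s^* : (s,s^* ) \in G(S)\} = H$. $S$ is called quasidense if, for all $(x,x^* ) \in H \times H$, $$\inf_{(s,s^* ) \in G(S)}\left[\tfrac12\|s - x\|^2 + \tfrac12\|s^* - x^*\|^2 + \langle s - x, s^* - x^*\rangle\right] \le 0.$$ *)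

(* Defs.v *)
From HB Require Import structures.
From mathcomp Require Import all_boot all_order all_algebra.
From mathcomp Require Import all_classical all_reals all_analysis.
Import Order.TTheory GRing.Theory Num.Theory.
Import numFieldNormedType.Exports.

Set Implicit Arguments.
Unset Strict Implicit.
Unset Printing Implicit Defensive.

Local Open Scope classical_set_scope.
Local Open Scope ring_scope.

(* The norm of H is the one induced by ip; with H : completeNormedModType R
   and ip positive definite, (H, ip) is then a real Hilbert space. *)
Definition norm_from_dot (R : realType) (H : completeNormedModType R)
    (ip : {dot H for idfun}) : Prop :=
  forall x : H, `|x| ^+ 2 = ip x x.

Definition multifunction (X Y : Type) : Type := X -> set Y.

Definition graph (X Y : Type) (S : multifunction X Y) : set (X * Y) :=
  [set p | S p.1 p.2].

Definition mf_closed (X Y : topologicalType) (S : multifunction X Y) : Prop :=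
  closed (graph S).

Definition mf_monotone (R : realType) (H : completeNormedModType R)
    (ip : {dot H for idfun}) (S : multifunction H H) : Prop :=
  forall p q : H * H, graph S p -> graph S q ->
    0 <= ip (p.1 - q.1) (p.2 - q.2).

(* The infimum is taken in the extended reals, so that it is +oo when the
   graph of S is empty. *)
Definition quasidense (R : realType) (H : completeNormedModType R)
    (ip : {dot H for idfun}) (S : multifunction H H) : Prop :=
  forall x xs : H,
    (ereal_inf [set (2^-1 * `|p.1 - x| ^+ 2 + 2^-1 * `|p.2 - xs| ^+ 2
                     + ip (p.1 - x) (p.2 - xs))%:E | p in graph S]
     <= 0)%E.

Definition mf_add (X : Type) (V : zmodType) (S T : multifunction X V) :
    multifunction X V :=
  fun x => [set s + t | s in S x & t in T x].

Definition mf_id (X : Type) : multifunction X X := fun x => [set x].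

Definition mf_surjective (X Y : Type) (S : multifunction X Y) : Prop :=
  [set p.2 | p in graph S] = [set: Y].

Lemma mf_add_idE (V : zmodType) (S : multifunction V V) (x : V) :
  mf_add S (@mf_id V) x = [set s + x | s in S x].
Proof.
apply/seteqP; split=> y /=; first by move=> [s Ss [t -> <-]]; exists s.
by move=> [s Ss <-]; exists s => //; exists x.
Qed.

Lemma mf_surjective_add_id (V : zmodType) (S : multifunction V V) :
  mf_surjective (mf_add S (@mf_id V)) <->
  [set p.1 + p.2 | p in graph S] = [set: V].
Proof.
rewrite /mf_surjective; suff -> : [set p.2 | p in graph (mf_add S (@mf_id V))] =
  [set p.1 + p.2 | p in graph S] by [].
apply/seteqP; split=> y /=.
  move=> [[x z]]; rewrite /graph /= mf_add_idE => -[s Ss <-] <-.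
  by exists (x, s) => //=; rewrite addrC.
move=> [[x s]]; rewrite /graph /= => Ss <-.
by exists (x, x + s) => //=; rewrite mf_add_idE; exists s => //; rewrite addrC.
Qed.

(* Main.v *)
Require Import Defs.
From HB Require Import structures.
From mathcomp Require Import all_boot all_order all_algebra.
From mathcomp Require Import all_classical all_reals all_analysis.
From mathcomp Require Import ring lra.
Import Order.TTheory GRing.Theory Num.Theory.
Import numFieldNormedType.Exports.
Local Open Scope classical_set_scope.
Local Open Scope ring_scope.

(** The form <., .> is symmetric, so the quantity whose infimum defines
quasidensity is a perfect square: with a = s - x and b = t - z,
  1/2 |a|^2 + 1/2 |b|^2 + <a, b> = 1/2 |a + b|^2
                                 = 1/2 |(s + t) - (x + z)|^2.
It depends on (x, z) only through x + z, which is an arbitrary point of H.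
Hence quasidensity of S means exactly that the range of S + I, which is the
image of G(S) under (s, t) |-> s + t, is dense ([quasidense_closureP]).

It remains to see that for a closed monotone S this range is closed.  By the
same expansion of the square, monotonicity makes the sum map expansive on the
graph ([monotone_expansive]): the distance between two points of G(S) is at
most the distance between their sums.  So if points of G(S) have sums
converging to y, these points form a Cauchy family; its limit exists by
completeness, lies in G(S) because G(S) is closed, and has sum y
([expansive_sum_closed]). *)

(** Completeness passes to binary products, because both projections are
uniformly continuous. *)
Lemma prod_cauchy_cvg (R : realType) (U V : completePseudoMetricType R)
    (F : set_system (U * V)) (FF : ProperFilter F) :
  cauchy_ex F -> exists p : U * V, F --> p.
Proof.
move=> Fcauchy.
have F1 : cvg (fst @ F).
  apply: cauchy_cvg; apply: cauchy_exP => e e0.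
  have [q Fq] := Fcauchy e e0; exists q.1.
  by apply: (@filterS _ F _ _ _ _ Fq) => p [? ?].
have F2 : cvg (snd @ F).
  apply: cauchy_cvg; apply: cauchy_exP => e e0.
  have [q Fq] := Fcauchy e e0; exists q.2.
  by apply: (@filterS _ F _ _ _ _ Fq) => p [? ?].
exists (lim (fst @ F), lim (snd @ F)).
move=> A /(cvg_pair F1 F2) FA.
by apply: (@filterS _ F _ _ _ _ FA) => -[].
Qed.

(** The approximants of a point y of the closure are organised as the filter
generated by the sets of points of G whose sum is within e of y; expansiveness
turns the shrinking of the sums into the Cauchy property of this filter. *)
Lemma expansive_sum_closed (R : realType) (H : completeNormedModType R)
    (G : set (H * H)) :
  closed G ->
  (forall p q, G p -> G q -> `|p - q| <= `|(p.1 + p.2) - (q.1 + q.2)|) ->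
  closed [set p.1 + p.2 | p in G].
Proof.
move=> Gclosed Gexp y ycl.
pose B (e : R) := [set p | G p /\ `|y - (p.1 + p.2)| < e].
pose F := filter_from [set e : R | 0 < e] B.
have FF : ProperFilter F.
  apply: filter_from_proper; last first.
    move=> e /= e0.
    have [_ [[p Gp <-] yp]] := ycl _ (nbhsx_ballx y e e0).
    by exists p; split=> //; move: yp; rewrite -ball_normE.
  apply: filter_from_filter; first by exists 1 => /=.
  move=> e1 e2 /= e10 e20; exists (Num.min e1 e2) => /=; first by rewrite lt_min e10.
  by move=> p [Gp]; rewrite lt_min => /andP[p1 p2]; split; split.
have FB e : 0 < e -> F (B e) by move=> e0; exists e.
have [p Fp] : exists p : H * H, F --> p.
  apply: prod_cauchy_cvg => e e0.
  have e20 : 0 < e / 2 by rewrite divr_gt0.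
  have [q [Gq yq]] := filter_ex (FB _ e20).
  exists q; apply: filterS (FB _ e20) => p [Gp yp].
  rewrite -ball_normE /=; apply: le_lt_trans (Gexp _ _ Gq Gp) _.
  rewrite (splitr e) -[_ - _](subrKA y); apply: le_lt_trans (ler_normD _ _) _.
  by rewrite ltrD// distrC.
exists p.
  apply: (@closed_cvg _ _ F FF id G Gclosed _ p Fp).
  by apply: (@filterS _ F _ _ _ _ (FB _ ltr01)) => q [].
have Fy : (q.1 + q.2) @[q --> F] --> y.
  by apply/cvgrPdist_lt => e e0; apply: (@filterS _ F _ _ _ _ (FB _ e0)) => q [].
have Fp1 : q.1 @[q --> F] --> p.1 by apply: cvg_comp Fp _; exact: cvg_fst.
have Fp2 : q.2 @[q --> F] --> p.2 by apply: cvg_comp Fp _; exact: cvg_snd.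
exact: (cvg_unique (@norm_hausdorff _ _) (cvgD Fp1 Fp2) Fy).
Qed.

Section InnerProduct.
Context (R : realType) (H : completeNormedModType R) (ip : {dot H for idfun}).
Hypothesis Hnorm : norm_from_dot ip.

Lemma dot_normD (x y : H) :
  `|x + y| ^+ 2 = `|x| ^+ 2 + `|y| ^+ 2 + 2 * ip x y.
Proof. by rewrite !Hnorm hnormD /= expr0 mul1r mulr2n mulrDl !mul1r. Qed.

(** The reason quasidensity only sees the sums s + s*. *)
Lemma quasidense_square (a b : H) :
  2^-1 * `|a| ^+ 2 + 2^-1 * `|b| ^+ 2 + ip a b = 2^-1 * `|a + b| ^+ 2.
Proof. by rewrite dot_normD; field. Qed.

(** Testing quasidensity at (y, 0) already gives the approximation of y by sums;
conversely, approximating x + xs gives quasidensity at (x, xs). *)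
Lemma quasidense_closureP (S : multifunction H H) :
  quasidense ip S <-> closure [set p.1 + p.2 | p in graph S] = setT.
Proof.
split=> [Sqd|Sdense].
  rewrite -subTset => y _ A /nbhs_ballP[e /= e0 eA].
  have e2 : (0 < (2^-1 * e ^+ 2)%:E)%E by rewrite lte_fin mulr_gt0 ?exprn_gt0.
  have [_ [p Sp <-]] := ereal_inf_lt (le_lt_trans (Sqd y 0) e2).
  rewrite quasidense_square lte_fin subr0 ltr_pM2l// ltr_pXn2r ?nnegrE ?(ltW e0)//.
  move=> py; exists (p.1 + p.2); split; first by exists p.
  by apply: eA; rewrite -ball_normE /= distrC addrAC.
move=> x xs; apply/lee_addgt0Pr => e e0; rewrite add0e.
(* d <= 1 and d <= e give 1/2 d^2 <= e, which avoids square roots. *)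
have d0 : 0 < Num.min 1 e by rewrite lt_min ltr01.
have : closure [set p.1 + p.2 | p in graph S] (x + xs) by rewrite Sdense.
move=> /(_ _ (nbhsx_ballx _ _ d0))[_ [[p Sp <-]]].
rewrite -ball_normE /= distrC lt_min => /andP[n1 ne].
apply: (@le_trans _ _ (2^-1 * `|p.1 + p.2 - (x + xs)| ^+ 2)%:E).
  apply: ereal_inf_lbound; exists p => //.
  by rewrite quasidense_square addrACA -opprD.
by rewrite lee_fin; have := normr_ge0 (p.1 + p.2 - (x + xs)); nra.
Qed.

(** Expanding |a + b|^2 with <a, b> >= 0 bounds both |a| and |b|, hence the
maximum of the two, which is the norm of the product, by |a + b|. *)
Lemma monotone_expansive (S : multifunction H H) : mf_monotone ip S ->
  forall p q, graph S p -> graph S q ->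
    `|p - q| <= `|(p.1 + p.2) - (q.1 + q.2)|.
Proof.
move=> Smono p q Sp Sq; have pq0 := Smono p q Sp Sq.
have := dot_normD (p.1 - q.1) (p.2 - q.2).
rewrite addrACA -opprD => npq.
by rewrite prod_normE ge_max /= -![`|_| <= _]ler_sqr ?nnegrE// npq; apply/andP;
  have := sqr_ge0 `|p.1 - q.1|; have := sqr_ge0 `|p.2 - q.2|; split; lra.
Qed.

End InnerProduct.

Theorem theorem6p1 (R : realType) (H : completeNormedModType R)
    (ip : {dot H for idfun}) (Hnorm : norm_from_dot ip)
    (Hnz : exists x : H, x != 0)
    (S : multifunction H H)
    (Sclosed : mf_closed S) (Smono : mf_monotone ip S)
    (Snonempty : graph S !=set0) :
  quasidense ip S <-> mf_surjective (mf_add S (@mf_id H)).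
Proof.
have rclosed :=
  expansive_sum_closed _ _ _ Sclosed (monotone_expansive _ _ _ Hnorm _ Smono).
apply: iff_trans (iff_sym (mf_surjective_add_id S)).
rewrite (proj1 (closure_id _) rclosed).
exact: (quasidense_closureP _ _ _ Hnorm S).
Qed.
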